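(* Let $\alpha>1$, and consider WARMs on graphs with $W(x)=x^\alpha$. (1) Let $G$ be the cycle graph with $n$ edges and $n$ vertices. The equilibrium $\vec 1/n=(1/n,\dots,1/n)$ is linearly stable if and only if $n$ is odd and $\alpha<\cos\left(\frac{\pi}{2n}\right)^{-2}$; it is critical when $n$ is odd and $\alpha=\cos\left(\frac{\pi}{2n}\right)^{-2}$. (2) Let $G$ be the complete graph on $n_v$ vertices, with $n=n_v(n_v-1)/2$ edges. The equilibrium $\vec 1/n$ is linearly stable if and only if $n=3$ and $\alpha<4/3$; it is critical when $n=3$ and $\alpha=4/3$.
   Context: WARM on a graph $G$ with vertex set $V$, edge set $E$, $|E|=n$: the colours are the edges of $G$, each with initial count 1; at each time a vertex is chosen uniformly at random from $V$ (independently of the past), and one edge $e$ incident to it is selected with probability proportional to $W(\text{current count of } e)$, where $W(x)=x^\alpha$, and its count is increased by one. With $\Delta_E=\{\vec v\in\mathbb R^E:v_e\ge0,\ \sum_{e}v_e=1\}$, define for $\vec v\in\Delta_E$ $$F(\vec v)_e=-v_e+\frac1{|V|}\sum_{x\in e}\frac{v_e^\alpha}{\sum_{e'\ni x}v_{e'}^\alpha},\qquad e\in E,$$ where $x\in e$ means that $x$ is an endvertex of $e$ (and $0/0$ is read as $0$). An equilibrium is a $\vec v\in\Delta_E$ with $F(\vec v)=\vec 0$. $\mathbf D(\vec v)$ is the matrix of partial derivatives $\partial F(\vec v)_e/\partial v_{e'}$, $e,e'\in E$. The equilibrium is linearly stable if all eigenvalues of $\mathbf D(\vec v)$ have negative real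 parts, linearly unstable if some eigenvalue has positive real part, and critical otherwise.
   Formalization: The complete graph is taken with n_v ≥ 3, since for n_v = 2 (one edge, n = 1) the derivative matrix is (−1) and the equilibrium is linearly stable though n ≠ 3, and for n_v = 1 there are no edges; the cycle graph is taken with n ≥ 3, as usual. *)

(* Defs.v *)
From HB Require Import structures.
From mathcomp Require Import all_boot all_order all_algebra.
From mathcomp Require Import all_classical all_reals all_analysis.
From mathcomp Require Import complex.
From mathcomp Require Import zify.

Set Implicit Arguments.
Unset Strict Implicit.
Unset Printing Implicit Defensive.

Import Order.TTheory GRing.Theory Num.Theory.
Import numFieldNormedType.Exports.

Local Open Scope ring_scope.

Record sgraph := SGraph {
  vertex : finType;
  edges : {set {set vertex}};
  edgesP : forall e, e \in edges -> #|e| = 2%N }.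

Definition edge (G : sgraph) : finType := {e : {set vertex G} | e \in edges G}.

Definition cycle_edges (n : nat) : {set {set 'I_n}} :=
  [set [set i; ordS i] | i : 'I_n].

Lemma ordS_val (n : nat) (i : 'I_n) :
  val (ordS i) = if i.+1 == n then 0%N else i.+1.
Proof.
rewrite /=; case: eqP => [->|/eqP ne]; first by rewrite modnn.
by rewrite modn_small // ltn_neqAle ne ltn_ord.
Qed.

Lemma cycle_edges_card2 (n : nat) : (2 < n)%N ->
  forall e, e \in cycle_edges n -> #|e| = 2%N.
Proof.
move=> n2 e /imsetP[i _ ->]; rewrite cards2.
case: eqP => // /(congr1 val); rewrite ordS_val -[val i]/(i : nat).
by case: eqP; lia.
Qed.

Definition cycle_graph (n : nat) (hn : (2 < n)%N) : sgraph :=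
  SGraph (@cycle_edges_card2 n hn).

Definition complete_edges (n : nat) : {set {set 'I_n}} :=
  [set e : {set 'I_n} | #|e| == 2%N].

Lemma complete_edges_card2 (n : nat) :
  forall e, e \in complete_edges n -> #|e| = 2%N.
Proof. by move=> e; rewrite inE => /eqP. Qed.

Definition complete_graph (n : nat) : sgraph :=
  SGraph (@complete_edges_card2 n).

Lemma card_edge_cycle (n : nat) (hn : (2 < n)%N) :
  #|edge (cycle_graph hn)| = n.
Proof.
rewrite card_sig /= (eq_card (B := cycle_edges n)) //.
rewrite card_imset ?card_ord // => i j /setP eij.
have: i \in [set j; ordS j] by rewrite -eij set21.
have: j \in [set i; ordS i] by rewrite eij set21.
rewrite !inE => /orP[/eqP-> //|/eqP ji] /orP[/eqP-> //|/eqP ij].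
have {ij}: val i = val (ordS j) by rewrite -ij.
have {ji}: val j = val (ordS i) by rewrite -ji.
rewrite !ordS_val -[val i]/(i : nat) -[val j]/(j : nat).
by case: eqP => ?; case: eqP => ?; lia.
Qed.

Lemma card_edge_complete (n : nat) :
  #|edge (complete_graph n)| = ((n * n.-1)./2)%N.
Proof.
rewrite card_sig /= (eq_card (B := complete_edges n)) //.
by rewrite card_draws card_ord bin2.
Qed.

Section WARM.
Variables (R : realType) (G : sgraph) (alpha : R).
Implicit Types v : edge G -> R.

Definition in_simplex v : Prop :=
  (forall e, 0 <= v e) /\ \sum_e v e = 1.

(* Division by zero is zero, which gives the convention 0/0 = 0. *)
Definition warmF v (e : edge G) : R :=
  - v e + #|vertex G|%:R^-1 *
    \sum_(x in val e)
      (v e `^ alpha / \sum_(e' : edge G | x \in val e') v e' `^ alpha).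

Definition equilibrium v : Prop := in_simplex v /\ forall e, warmF v e = 0.

(* [`^] takes the value 1 at negative bases, so these derivatives are the
   intended ones only at points all of whose coordinates are positive. *)
Definition warmF_partial v (e e' : edge G) : R :=
  derive1 (fun t : R => warmF [eta v with e' |-> t] e) (v e').

Definition warmD v : 'M[R]_#|edge G| :=
  \matrix_(i, j) warmF_partial v (enum_val i) (enum_val j).

Definition warmD_eigenvalue v (z : R[i]) : Prop :=
  eigenvalue (map_mx (real_complex R) (warmD v)) z.

Definition linearly_stable v : Prop :=
  forall z, warmD_eigenvalue v z -> complex.Re z < 0.

Definition linearly_unstable v : Prop :=
  exists z, warmD_eigenvalue v z /\ 0 < complex.Re z.

Definition critical v : Prop := ~ linearly_stable v /\ ~ linearly_unstable v.

End WARM.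

(* Main.v *)
(** On a d-regular graph the Jacobian at the uniform point is
    (alpha - 1) I - alpha / (2 d) M, where M e e' is the number of common ends
    of e and e'.  On the cycle M = 2 + S + S^-1 for the cyclic shift S, so its
    eigenvalues are 2 (1 + cos t) with cos (n t) = 1; the smallest one is 0
    (t = pi) for n even and 2 - 2 cos (pi / n) (t = pi - pi / n) for n odd.
    A complete graph on more than 3 vertices has more edges than vertices, so
    some nonzero edge weight sums to 0 around each vertex; it lies in the
    kernel of M and gives the positive eigenvalue alpha - 1.  The complete
    graph on 3 vertices is the 3-cycle, and cos (pi / 6) ^ -2 = 4 / 3. *)
Require Import Defs.
From mathcomp Require Import all_boot all_order all_algebra.
From mathcomp Require Import all_classical all_reals all_analysis.
From mathcomp Require Import complex.
From mathcomp Require Import ring lra zify.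

Import Order.TTheory GRing.Theory Num.Theory.
Import numFieldNormedType.Exports.
Local Open Scope ring_scope.
Local Open Scope complex_scope.

(** * Derivatives of finite sums *)

Lemma is_derive_big_sum (R : realType) (I : Type) (r : seq I) (P : pred I)
    (f : I -> R -> R) (x : R) (df : I -> R) :
  (forall i, P i -> is_derive x (1 : R) (f i) (df i)) ->
  is_derive x (1 : R) (fun t => \sum_(i <- r | P i) f i t)
    (\sum_(i <- r | P i) df i).
Proof.
move=> fD; elim: r => [|i r IH].
  rewrite big_nil; have -> : (fun t => \sum_(i <- [::] | P i) f i t) = cst 0.
    by apply/funext => t; rewrite big_nil.
  exact: is_derive_cst.
have -> : (fun t => \sum_(j <- i :: r | P j) f j t) =
    (if P i then f i else cst 0) + (fun t => \sum_(j <- r | P j) f j t).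
  apply/funext => t; rewrite big_cons fctE; case: (P i) => //=.
  by rewrite add0r.
rewrite big_cons; case: ifP => Pi.
  by apply: is_deriveD; exact: fD.
rewrite -[X in is_derive _ _ _ X]add0r; exact: is_deriveD.
Qed.

(** * Jacobian at the uniform point of a regular graph *)

Section Regular.
Variables (R : realType) (G : sgraph) (alpha u : R) (d : nat).
Hypothesis u_gt0 : 0 < u.
Hypothesis d_gt0 : (0 < d)%N.
Hypothesis regular : forall x : vertex G, #|[set e : edge G | x \in val e]| = d.
(** When [u] is the inverse of the number of edges, this is the handshake identity |V| d = 2 |E|. *)
Hypothesis handshake : #|vertex G|%:R * d%:R * u = 2.
Implicit Types e : edge G.

Lemma sum_incident_const (x : vertex G) (c : R) :
  \sum_(e : edge G | x \in val e) c = d%:R * c.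
Proof.
rewrite sumr_const -(regular x) mulr_natl; congr (_ *+ _).
by apply: eq_card => e; rewrite !inE.
Qed.

Lemma sum_ends_const e (c : R) : \sum_(x in val e) c = 2 * c.
Proof. by rewrite sumr_const (edgesP (valP e)) mulr_natl. Qed.

Let d_neq0 : d%:R != 0 :> R. Proof. by rewrite pnatr_eq0 -lt0n. Qed.
Let V_neq0 : #|vertex G|%:R != 0 :> R.
Proof.
apply/eqP => V0; have : (0 : R) = 2 by rewrite -handshake V0 !mul0r.
lra.
Qed.

(** Each vertex sum is d u^alpha, so every quotient is 1/d and F_e = -u + 2 / (|V| d), which
    vanishes by [handshake]. *)
Lemma warmF_uniform e : warmF alpha (fun=> u) e = 0.
Proof.
rewrite /warmF; have p0 : u `^ alpha != 0 by rewrite gt_eqF // powR_gt0.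
under eq_bigr do rewrite sum_incident_const.
rewrite sum_ends_const.
have -> : u = 2 / (#|vertex G|%:R * d%:R).
  by rewrite -handshake mulrC mulKf // mulf_neq0.
have u0 : 2 / (#|vertex G|%:R * d%:R) != 0 :> R.
  by rewrite mulf_neq0 ?invr_eq0 ?mulf_neq0 // pnatr_eq0.
have : (2 / (#|vertex G|%:R * d%:R)) `^ alpha != 0 :> R.
  by rewrite powR_eq0 negb_and u0.
by move=> q0; field; rewrite d_neq0 V_neq0 q0.
Qed.

(** The quotient rule at each end of [e] produces the factor alpha / (|V| d u), which [handshake]
    turns into alpha / 2. *)
Lemma warmF_partial_uniform e e' :
  warmF_partial alpha (fun=> u) e e' =
    - (e == e')%:R + alpha / 2 * \sum_(x in val e)
        ((e == e')%:R - (x \in val e')%:R / d%:R).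
Proof.
rewrite /warmF_partial derive1E.
have p0 : u `^ alpha != 0 by rewrite gt_eqF // powR_gt0.
(* Numerator and denominator when only coordinate [e'] moves. The indicators make both affine in
   t^alpha, so one differentiation covers all positions of [e']. *)
pose N t := (e == e')%:R * (t `^ alpha) + (1 - (e == e')%:R) * u `^ alpha.
pose S x t := (x \in val e')%:R * (t `^ alpha) +
  (d%:R - (x \in val e')%:R) * u `^ alpha.
have -> : (fun t : R => warmF alpha [eta (fun=> u) with e' |-> t] e) =
    (fun t : R => - ((e == e')%:R * t + (1 - (e == e')%:R) * u) +
       #|vertex G|%:R^-1 * \sum_(x in val e) (N t / S x t)).
  apply/funext => t; rewrite /warmF /=; congr (- _ + _ * _).
    by case: (e == e') => /=; ring.
  apply: eq_bigr => x _; congr (_ / _).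
    by rewrite /N; case: (e == e') => /=; ring.
  (* Writing d u^alpha as a sum over the edges at [x] lets the term of [e'] be exchanged for
     t^alpha. *)
  have := sum_incident_const x (u `^ alpha); rewrite /S mulrBl => <-.
  case: (boolP (x \in val e')) => xe' /=.
    rewrite !mul1r (bigD1 e') //= eqxx [in RHS](bigD1 e') //=.
    rewrite [in RHS]addrAC subrr add0r; congr (_ + _).
    by apply: eq_bigr => j /andP[_ /negPf ->].
  rewrite !mul0r add0r subr0; apply: eq_bigr => j xj.
  by case: eqP => // jE; move: xe'; rewrite -jE xj.
have dp : is_derive u (1 : R) (fun t => t `^ alpha) (alpha * u `^ (alpha - 1)).
  exact: is_derive1_powR.
have pE : u `^ (alpha - 1) = u `^ alpha / u.
  by rewrite powRB ?powRr1 ?(ltW u_gt0) // (gt_eqF u_gt0) ?implybT.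
have affD (a b : R) : is_derive u (1 : R) (fun t => a * t `^ alpha + b)
    (a * (alpha * u `^ (alpha - 1))).
  rewrite -[X in is_derive _ _ _ X]addr0; apply: is_deriveD.
have linD (a b : R) : is_derive u (1 : R) (fun t => - (a * t + b)) (- a).
  rewrite -[X in is_derive _ _ _ (- X)]addr0; apply: is_deriveN.
  apply: is_deriveD; rewrite -[X in is_derive _ _ _ X]mulr1.
  exact: (is_deriveZ a (is_derive_id _ _)).
have Su x : S x u = d%:R * u `^ alpha by rewrite /S mulrBl addrCA subrr addr0.
have Nu : N u = u `^ alpha by rewrite /N mulrBl addrCA subrr addr0 mul1r.
have quotD x : is_derive u (1 : R) (fun t => N t / S x t)
    (alpha / (u * d%:R) * ((e == e')%:R - (x \in val e')%:R / d%:R)).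
  have S0 : S x u != 0 by rewrite Su mulf_neq0.
  have NSD : is_derive u (1 : R) (fun t => N t / S x t) _ :=
    is_deriveM (affD _ _ : is_derive _ _ N _)
      (is_deriveV S0 (affD _ _ : is_derive _ _ (S x) _)).
  apply: (is_derive_eq NSD); rewrite Su Nu pE /GRing.scale /=.
  by field; rewrite d_neq0 p0 gt_eqF.
have := is_deriveD (linD _ _) (is_deriveZ #|vertex G|%:R^-1
  (is_derive_big_sum _ _ (index_enum _) (mem (val e)) _ _ _
    (fun x _ => quotD x))).
move=> /(_ (e == e')%:R ((1 - (e == e')%:R) * u)) D.
rewrite (@derive_val _ _ _ _ _ _ _ D) -mulr_sumr; congr (- _ + _).
rewrite /GRing.scale /= mulrA; congr (_ * _).
have -> : alpha / 2 = alpha / (#|vertex G|%:R * d%:R * u) by rewrite handshake.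
by field; rewrite d_neq0 V_neq0 gt_eqF.
Qed.

(** The sum runs over the first index because [eigenvalue] is defined by row vectors. Counting
    common ends of two edges and exchanging sums leaves incidence sums of [f] at the ends of [e]. *)
Lemma warmD_mul_row (f : edge G -> R[i]) e :
  \sum_e' f e' * (warmF_partial alpha (fun=> u) e' e)%:C =
    (alpha - 1)%:C * f e - (alpha / (2 * d%:R))%:C *
      \sum_(x in val e) \sum_(e' : edge G | x \in val e') f e'.
Proof.
have expand e' : f e' * (warmF_partial alpha (fun=> u) e' e)%:C =
    (if e' == e then (alpha - 1)%:C * f e else 0) -
    (alpha / (2 * d%:R))%:C *
      \sum_(x in val e) (if x \in val e' then f e' else 0).
  rewrite warmF_partial_uniform sumrB sum_ends_const -mulr_suml.
  have -> : \sum_(x in val e) (if x \in val e' then f e' else 0) =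
      (\sum_(x in val e') (x \in val e)%:R)%:C * f e'.
    rewrite rmorph_sum mulr_suml big_mkcond [RHS]big_mkcond.
    apply: eq_bigr => x _.
    by case: (x \in val e); case: (x \in val e'); rewrite ?mul1r ?mul0r.
  set k := \sum_(x in val e') _.
  have -> : - (e' == e)%:R + alpha / 2 * (2 * (e' == e)%:R - k / d%:R) =
      (alpha - 1) * (e' == e)%:R - alpha / (2 * d%:R) * k by field.
  rewrite rmorphB !rmorphM /= mulrBr.
  case: eqP => [->|_]; rewrite ?mulr1 ?mulr0; ring.
under eq_bigr do rewrite expand.
rewrite sumrB -big_mkcond /= big_pred1_eq -mulr_sumr exchange_big /=.
by under [in RHS]eq_bigr do rewrite big_mkcond.
Qed.

(** Reindexing by [enum_val] trades row vectors for functions on edges, so the spectrum can be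
    studied through incidence sums. *)
Lemma uniform_eigenvalueP z :
  warmD_eigenvalue alpha (fun _ : edge G => u) z <->
  exists2 f : edge G -> R[i], exists e, f e != 0 &
    forall e, (alpha - 1)%:C * f e - (alpha / (2 * d%:R))%:C *
      (\sum_(x in val e) \sum_(e' : edge G | x \in val e') f e') = z * f e.
Proof.
pose D := map_mx (real_complex R) (warmD alpha (fun _ : edge G => u)).
have rowE (w : 'rV_#|edge G|) j : (w *m D) 0 j =
    \sum_e w 0 (enum_rank e) *
      (warmF_partial alpha (fun=> u) e (enum_val j))%:C.
  rewrite mxE (reindex (@enum_val (edge G) predT)) /=; last first.
    by apply: onW_bij; exact: enum_val_bij.
  by apply: eq_bigr => i _; rewrite !mxE enum_valK.
split=> [/eigenvalueP[w wD w0]|[f [e0 fe0] fD]].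
  exists (fun e => w 0 (enum_rank e)).
    have /rV0Pn[j wj] := w0.
    by exists (enum_val j); rewrite enum_valK.
  move=> e; rewrite -(warmD_mul_row (fun e => w 0 (enum_rank e))).
  by rewrite -[in LHS](enum_rankK e) -rowE wD mxE.
apply/eigenvalueP; exists (\row_j f (enum_val j)).
  apply/rowP => j; rewrite rowE !mxE -fD -warmD_mul_row.
  by apply: eq_bigr => e _; rewrite mxE enum_rankK.
by apply/rV0Pn; exists (enum_rank e0); rewrite mxE enum_rankK.
Qed.

Lemma uniform_equilibrium : #|edge G|%:R * u = 1 ->
  equilibrium alpha (fun _ : edge G => u).
Proof.
move=> Eu; split; last exact: warmF_uniform.
by split=> [e|]; [exact: ltW | rewrite sumr_const -mulr_natl].
Qed.

(** The incidence term vanishes on [f], leaving the positive eigenvalue alpha - 1. *)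
Lemma uniform_unstable_of_kernel (f : edge G -> R) : 1 < alpha ->
  (exists e, f e != 0) ->
  (forall x, \sum_(e : edge G | x \in val e) f e = 0) ->
  ~ linearly_stable alpha (fun _ : edge G => u).
Proof.
move=> a1 [e0 fe0] f0 /(_ (alpha - 1)%:C) st.
have /st /= : warmD_eigenvalue alpha (fun _ : edge G => u) (alpha - 1)%:C.
  apply/uniform_eigenvalueP; exists (fun e => (f e)%:C).
    by exists e0; rewrite fmorph_eq0.
  move=> e; rewrite big1 ?mulr0 ?subr0 // => x _.
  by rewrite -rmorph_sum f0.
by rewrite subr_lt0 ltNge ltW.
Qed.

(** The incidence matrix [B] has more rows than columns, hence a nonzero row vector killed by it;
    its column at [x] is the sum around [x]. *)
Lemma uniform_unstable_of_card : 1 < alpha -> (#|vertex G| < #|edge G|)%N ->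
  ~ linearly_stable alpha (fun _ : edge G => u).
Proof.
move=> a1 VE.
pose B : 'M[R]_(#|edge G|, #|vertex G|) :=
  \matrix_(i, j)
    ((enum_val j : vertex G) \in val (enum_val i : edge G))%:R.
have /rowV0Pn[w /sub_kermxP wB w0] : kermx B != 0.
  by rewrite kermx_eq0 /row_free neq_ltn (leq_ltn_trans (rank_leq_col B)).
apply: (@uniform_unstable_of_kernel (fun e => w 0 (enum_rank e)) a1).
  by have /rV0Pn[j wj] := w0; exists (enum_val j); rewrite enum_valK.
move=> x; have /rowP/(_ (enum_rank x)) := wB.
rewrite !mxE => wBx.
rewrite -[RHS]wBx big_mkcond (reindex (@enum_val (edge G) predT)) /=.
  apply: eq_bigr => i _; rewrite !mxE enum_rankK enum_valK.
  by case: ifP; rewrite ?mulr1 ?mulr0.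
by apply: onW_bij; exact: enum_val_bij.
Qed.
End Regular.

(** * Cosines, roots of unity and cyclic sequences *)

Lemma cosD_even_pi (R : realType) (n : nat) (x : R) :
  ~~ odd n -> cos (x + n%:R * pi) = cos x.
Proof.
move=> n_even; rewrite mulr_natl (alternatingn (@cosDpi R)).
by rewrite -signr_odd (negbTE n_even) mul1r.
Qed.

(** Otherwise t > pi - pi/n, so s = n t - (n-1) pi lies in (0, pi]. As n - 1 is even, cos s = cos (n
    t) = 1, which is impossible there. *)
Lemma cos_eq1_ge (R : realType) (n : nat) (t : R) : odd n ->
  0 <= t <= pi -> cos (n%:R * t) = 1 -> - cos (pi / n%:R) <= cos t.
Proof.
move=> n_odd /andP[t0 tpi] cos1.
have n0 : (0 < n)%N by case: n n_odd {cos1}.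
have n0R : (0 < n%:R :> R) by rewrite ltr0n.
have n1R : (1 <= n%:R :> R) by rewrite ler1n.
have pi0 := pi_gt0 R.
rewrite leNgt; apply/negP => tlt.
have : cos t < cos (pi - pi / n%:R) by rewrite addrC cosDpi cosN.
have pin : 0 <= (pi : R) / n%:R <= pi.
  by rewrite divr_ge0 ?pi_ge0 //= ler_pdivrMr // ler_peMr // pi_ge0.
move: pin => /andP[pin0 pin1].
rewrite ltr_cos ?in_itv /= ?t0 ?tpi //; last by lra.
rewrite -(ltr_pM2l n0R) mulrBr mulrCA divff ?gt_eqF // mulr1 => ltt.
have nE : n%:R = n.-1%:R + 1 :> R by rewrite natr1 prednK.
pose s := n%:R * t - n.-1%:R * pi.
have sE : cos s = cos 0.
  rewrite cos0 -cos1 -[in RHS](subrK (n.-1%:R * pi) (n%:R * t)).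
  by rewrite cosD_even_pi // -oddS prednK // n_odd.
have ntpi : n%:R * t <= n%:R * pi by rewrite ler_pM2l.
have : 0 < s by rewrite /s; move: ltt; rewrite nE; lra.
have spi : s <= pi by rewrite /s; move: ntpi; rewrite nE; lra.
move=> s0; have : cos s < cos 0.
  by rewrite ltr_cos // in_itv /= ?lexx ?(ltW s0) ?(ltW pi0).
by rewrite sE ltxx.
Qed.

(** Such an l lies on the unit circle, so its inverse is its conjugate and t = acos (Re l) works;
    the real part of De Moivre's formula gives cos (n t) = 1. *)
Lemma unity_root_cos (R : realType) (n : nat) (l : R[i]) :
  (0 < n)%N -> l ^+ n = 1 ->
  exists2 t : R, 0 <= t <= pi & cos (n%:R * t) = 1 /\
    l + l^-1 = (2 * cos t)%:C.
Proof.
move=> n0 ln1.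
have : `|l| = 1.
  by apply/eqP; rewrite -(@pexpr_eq1 _ _ n) // -normrX ln1 normr1.
case: l ln1 => a b ln1 nl.
have ab2 : a ^+ 2 + b ^+ 2 = 1.
  by apply: complexI; rewrite (add_Re2_Im2 (a +i* b)) nl expr1n.
have a1 : -1 <= a <= 1.
  rewrite -ler_norml -ler_sqr ?nnegrE // expr1n real_normK ?num_real //.
  by rewrite -ab2 lerDl sqr_ge0.
exists (acos a); first by rewrite acos_ge0 // acos_lepi.
have ca : cos (acos a) = a by rewrite acosK // in_itv.
set t := acos a in ca *.
(* Since [acos] only returns angles of the upper half circle, the sign [s] records the half in which
   l lies. *)
have [s s2 bE] : exists2 s : R, s ^+ 2 = 1 & b = s * sin t.
  have /eqP : sin t ^+ 2 = b ^+ 2.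
    by rewrite sin2cos2 ca -ab2 addrAC subrr add0r.
  rewrite eqf_sqr => /orP[/eqP|/eqP] ->.
    by exists 1; rewrite ?expr1n ?mul1r.
  by exists (-1); rewrite ?sqrrN ?expr1n ?mulN1r ?opprK.
have moivre k : (a +i* b) ^+ k = cos (k%:R * t) +i* (s * sin (k%:R * t)).
  elim: k => [|k IH].
    by rewrite expr0 mul0r cos0 sin0 mulr0.
  rewrite exprS IH -ca bE mulrSr mulrDl mul1r cosD sinD.
  apply/eqP; rewrite eq_complex /=; apply/andP; split; apply/eqP; last by ring.
  have -> : cos t * cos (k%:R * t) - s * sin t * (s * sin (k%:R * t)) =
    cos t * cos (k%:R * t) - s ^+ 2 * (sin t * sin (k%:R * t)) by ring.
  by rewrite s2; ring.
split.
  by have := congr1 (@complex.Re R) ln1; rewrite moivre /=.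
apply/eqP; rewrite eq_complex /= ab2 ca invr1 !mulr1.
by rewrite ?divr1 ?subrr eqxx andbT mulr_natl mulr2n.
Qed.

(** Going once round the cycle from [i0] multiplies the value by l^n and returns to [i0]. *)
Lemma geometric_unity_root (F : fieldType) (n : nat) (h : 'I_n -> F) (l : F)
    (i0 : 'I_n) : h i0 != 0 -> (forall i, h (ordS i) = l * h i) -> l ^+ n = 1.
Proof.
move=> hi0 hS.
have iterE k : val (iter k (@ordS n) i0) = ((i0 + k) %% n)%N.
  elim: k => [|k IH]; first by rewrite addn0 modn_small.
  by rewrite iterS /= IH -addn1 modnDml addn1 addnS.
have hk k : h (iter k (@ordS n) i0) = l ^+ k * h i0.
  elim: k => [|k IH]; first by rewrite mul1r.
  by rewrite iterS hS IH exprS mulrA.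
apply: (mulIf hi0); rewrite mul1r -hk; congr h.
by apply: val_inj; rewrite iterE modnDr modn_small.
Qed.

(* The shift S satisfies (S - l)(S - l^-1) g = 0 for l + l^-1 = m, so one of
   l, l^-1 is an eigenvalue of the cyclic shift. *)
Lemma circulant_eigen (F : closedFieldType) (n : nat) (g : 'I_n -> F) (m : F)
    (i0 : 'I_n) : g i0 != 0 ->
  (forall i, g (ord_pred i) + g (ordS i) = m * g i) ->
  exists2 l : F, l ^+ n = 1 & m = l + l^-1.
Proof.
move=> gi0 gm.
have [l lE] : exists l : F, l ^+ 2 = m * l - 1.
  (* The list holds the lower coefficients, so l is a root of X^2 - m X + 1. *)
  have [l] := @GRing.solve_monicpoly F 2 (nth 0 [:: -1; m]) isT.
  rewrite !big_ord_recl big_ord0 /= expr1 expr0 => lE.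
  by exists l; rewrite lE; ring.
have l0 : l != 0.
  apply: contra_eq_neq lE => ->.
  by rewrite expr0n mulr0 sub0r eq_sym oppr_eq0 oner_eq0.
have mE : m = l + l^-1.
  apply: (mulIf l0); rewrite mulrDl mulVf // -expr2 lE; ring.
pose h i := g (ordS i) - l^-1 * g i.
have hS i : h (ordS i) = l * h i.
  have := gm (ordS i); rewrite ordSK mE /h => gi.
  apply/eqP; rewrite -subr_eq0; apply/eqP.
  have -> : g (ordS (ordS i)) = (l + l^-1) * g (ordS i) - g i.
    by rewrite -gi; ring.
  by field.
(* If [h] is nonzero somewhere, it is geometric with ratio l; if it vanishes, [g] itself is
   geometric with ratio l^-1. *)
have [/existsP[i hi]|/existsPn h0] := boolP [exists i, h i != 0].
  by exists l => //; apply: geometric_unity_root hi hS.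
exists l => //; apply: (can_inj invrK); rewrite invr1 -exprVn.
apply: geometric_unity_root gi0 _ => i.
by apply/eqP; rewrite -subr_eq0; have := h0 i; rewrite negbK.
Qed.

(** * Spectrum and stability on the cycle *)

Section Cycle.
Variables (n : nat) (hn : (2 < n)%N).
Notation G := (cycle_graph hn).

Lemma mem_cycle_edges (i : 'I_n) : [set i; ordS i] \in edges G.
Proof. exact: imset_f. Qed.

Definition cycle_edge (i : 'I_n) : edge G :=
  exist _ [set i; ordS i] (mem_cycle_edges i).

(** Injectivity comes from counting: the n indices hit every edge, and there are n edges. *)
Lemma cycle_edge_bij : bijective cycle_edge.
Proof.
apply: inj_card_bij; last by rewrite card_edge_cycle card_ord.
apply/injectiveP; apply/card_uniqP; rewrite size_map -cardE card_ord.
rewrite -[RHS](card_edge_cycle hn); apply: eq_card => -[e eG].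
rewrite [RHS]inE; apply/mapP.
case/imsetP: (eG) => i _ eE; exists i; first by rewrite mem_enum.
exact: val_inj.
Qed.

Lemma ordS_neq (i : 'I_n) : ordS i != i.
Proof.
apply/eqP => /(congr1 val); rewrite ordS_val /=.
by case: eqP; lia.
Qed.

(** With edges indexed by their first vertex, [x] lies on edge x and on edge x - 1, which are
    distinct by [ordS_neq]. *)
Lemma cycle_sum_incident (V : nmodType) (f : edge G -> V) (x : 'I_n) :
  \sum_(e : edge G | x \in val e) f e =
    f (cycle_edge x) + f (cycle_edge (ord_pred x)).
Proof.
rewrite (reindex cycle_edge) /=; last exact/onW_bij/cycle_edge_bij.
rewrite (bigD1 x) /=; last by rewrite set21.
rewrite (bigD1 (ord_pred x)) /=; last first.
  by rewrite ord_predK set22 eq_sym -{1}(ord_predK x) ordS_neq.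
rewrite big1 ?addr0 // => i; rewrite !inE.
case/andP => /andP[/orP[/eqP->|/eqP->]]; first by rewrite eqxx.
by rewrite ordSK eqxx.
Qed.

Lemma cycle_sum_ends (V : nmodType) (F : 'I_n -> V) (i : 'I_n) :
  \sum_(x in val (cycle_edge i)) F x = F i + F (ordS i).
Proof. by rewrite big_setU1 ?big_set1 // inE eq_sym ordS_neq. Qed.

Lemma cycle_regular (x : vertex G) : #|[set e : edge G | x \in val e]| = 2.
Proof. by rewrite -sum1dep_card cycle_sum_incident. Qed.

Variables (R : realType) (alpha : R).
Let u : R := n%:R^-1.
Hypothesis alpha_gt1 : 1 < alpha.
Let n_gt0 : (0 < n)%N. Proof. by lia. Qed.
Let u_gt0 : 0 < u. Proof. by rewrite invr_gt0 ltr0n. Qed.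

Let cycle_handshake : #|vertex G|%:R * 2%:R * u = 2.
Proof. by rewrite card_ord mulrAC divff ?mul1r // pnatr_eq0 -lt0n. Qed.

Lemma cycle_equilibrium : equilibrium alpha (fun _ : edge G => u).
Proof.
apply: (uniform_equilibrium _ _ _ _ 2) => //; first exact: cycle_regular.
by rewrite card_edge_cycle divff // pnatr_eq0 -lt0n.
Qed.

(** In cyclic indexing the incidence operator is 2 + S + S^-1, and alpha / (2 d) is alpha / 4 for d
    = 2. *)
Lemma cycle_eigenvalueP z :
  warmD_eigenvalue alpha (fun _ : edge G => u) z <->
  exists2 g : 'I_n -> R[i], exists i, g i != 0 &
    forall i, (alpha - 1)%:C * g i - (alpha / 4)%:C *
      (2 * g i + (g (ord_pred i) + g (ordS i))) = z * g i.
Proof.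
have opE (f : edge G -> R[i]) i :
    \sum_(x in val (cycle_edge i)) \sum_(e' : edge G | x \in val e') f e' =
    2 * f (cycle_edge i) +
      (f (cycle_edge (ord_pred i)) + f (cycle_edge (ordS i))).
  rewrite cycle_sum_ends !cycle_sum_incident ordSK; ring.
have a4 : alpha / 4 = alpha / (2 * 2) by congr (_ / _); ring.
have [c' ck kc] := cycle_edge_bij.
split.
  move=> /(uniform_eigenvalueP _ _ _ _ 2 u_gt0 isT cycle_regular
    cycle_handshake).
  move=> [f [e fe] fD]; exists (f \o cycle_edge).
    by exists (c' e); rewrite /= kc.
  by move=> i; rewrite a4 -opE fD.
move=> [g [i gi] gD].
apply/(uniform_eigenvalueP _ _ _ _ 2 u_gt0 isT cycle_regular cycle_handshake).
exists (g \o c'); first by exists (cycle_edge i); rewrite /= ck.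
by move=> e; rewrite -(kc e) opE /= !ck -a4 gD.
Qed.

Lemma cycle_eigenvalue_cos z :
  warmD_eigenvalue alpha (fun _ : edge G => u) z <->
  exists2 t : R, 0 <= t <= pi & cos (n%:R * t) = 1 /\
    z = (alpha - 1 - alpha / 2 * (1 + cos t))%:C.
Proof.
rewrite cycle_eigenvalueP; split.
  have a4 : (alpha / 4)%:C != 0 :> R[i].
    by rewrite fmorph_eq0 gt_eqF // divr_gt0 // (lt_trans _ alpha_gt1).
  move=> [g [i0 gi0] gD].
  (* The multiplier is the eigenvalue equation solved for the sum of the two neighbours. *)
  have [|l ln ml] := circulant_eigen _ n g
      ((alpha / 4)%:C^-1 * ((alpha - 1)%:C - (alpha / 4)%:C * 2 - z)) i0 gi0.
    move=> i; apply: (mulfI a4); rewrite 2!mulrA mulfV // mul1r.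
    rewrite mulrBl -gD; ring.
  have [t t0pi [cos1 lt]] := unity_root_cos R n l n_gt0 ln.
  exists t => //; split => //.
  have -> : z = (alpha - 1)%:C - (alpha / 4)%:C * 2 -
      (alpha / 4)%:C * (2 * cos t)%:C.
    rewrite -lt -ml mulrA mulfV // mul1r; ring.
  have -> : 2 = 2%:C :> R[i] by rewrite rmorph_nat.
  by rewrite -!rmorphM -!rmorphB; congr _%:C; field.
move=> [t _ [cos1 ->]].
have sin0 : sin (n%:R * t) = 0 by apply: cos1sin0; rewrite cos1 normr1.
(* The real part of the geometric sequence with ratio exp (i t). It closes up around the cycle
   because cos (n t) = 1 and sin (n t) = 0. *)
exists (fun i : 'I_n => (cos (i%:R * t))%:C).
  exists (Ordinal n_gt0); rewrite /= mul0r cos0; exact: oner_neq0.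
have cosS (i : 'I_n) : cos ((ordS i)%:R * t) = cos (i%:R * t + t).
  have -> : i%:R * t + t = i.+1%:R * t by rewrite mulrSr mulrDl mul1r.
  rewrite -[(ordS i : nat)]/(val (ordS i)) ordS_val.
  by case: eqP => // ->; rewrite mul0r cos0 cos1.
have cosP (i : 'I_n) : cos ((ord_pred i)%:R * t) = cos (i%:R * t - t).
  have [i0|i0] := posnP i.
    rewrite i0 mul0r sub0r cosN.
    have -> : (ord_pred i : nat) = n.-1.
      by rewrite /= i0 add0n modn_small ?prednK.
    have -> : n.-1%:R * t = n%:R * t - t.
      by rewrite -{2}(prednK n_gt0) mulrSr mulrDl mul1r addrK.
    by rewrite cosB cos1 sin0 mul1r mul0r addr0.
  have iE : ((ord_pred i).+1 = i :> nat)%N.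
    have := ordS_val (ord_pred i); rewrite ord_predK -[val i]/(i : nat).
    by case: eqP; lia.
  by rewrite -[in RHS]iE mulrSr mulrDl mul1r addrK.
move=> i; rewrite cosS cosP cosB cosD.
have -> : 2 = 2%:C :> R[i] by rewrite rmorph_nat.
by rewrite -!(rmorphM, rmorphD, rmorphB) /=; congr _%:C; field.
Qed.

(** Rewrites alpha - 1 - alpha/2 (1 - cos (pi/n)) as alpha cos (pi/(2n))^2 - 1, the form that yields
    the threshold. *)
Lemma cos2_half_angle :
  cos (pi / n%:R) = 2 * cos (pi / (2 * n%:R)) ^+ 2 - 1 :> R.
Proof.
have -> : pi / n%:R = (pi / (2 * n%:R)) *+ 2 :> R.
  by rewrite -mulr_natl; field; rewrite pnatr_eq0 -lt0n.
by rewrite cos_mulr2n -mulr_natl.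
Qed.

Lemma cos_half_angle_gt0 : 0 < cos (pi / (2 * n%:R)) :> R.
Proof.
have pi0 := pi_gt0 R.
have nR : 0 < n%:R :> R by rewrite ltr0n.
have n2 : pi / (2 * n%:R) < pi / 2 :> R.
  rewrite ltr_pM2l // ltf_pV2 ?posrE ?mulr_gt0 // ltr_pMr // ltr1n; lia.
have : 0 < pi / (2 * n%:R) :> R by rewrite divr_gt0 ?mulr_gt0.
by move=> ?; apply: cos_gt0_pihalf; lra.
Qed.

Lemma cycle_eigenvalue_max : odd n ->
  warmD_eigenvalue alpha (fun _ : edge G => u)
    (alpha * cos (pi / (2 * n%:R)) ^+ 2 - 1)%:C.
Proof.
move=> n_odd; apply/cycle_eigenvalue_cos.
have nR : 0 < n%:R :> R by rewrite ltr0n.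
have pi0 := pi_gt0 R.
have pin : pi / n%:R <= pi :> R.
  by rewrite ler_pdivrMr // ler_peMr ?ler1n // ltW.
have pin0 : 0 <= pi / n%:R :> R by rewrite divr_ge0 ?ltW.
(* Here n t = (n-1) pi, an even multiple of pi for odd n. *)
exists (pi - pi / n%:R); first by apply/andP; split; lra.
split.
  have -> : n%:R * (pi - pi / n%:R) = 0 + n.-1%:R * pi :> R.
    rewrite -{1 2}(prednK n_gt0) -natr1; field.
    by rewrite natr1 pnatr_eq0.
  by rewrite cosD_even_pi ?cos0 // -oddS prednK // n_odd.
have -> : cos (pi - pi / n%:R) = - cos (pi / n%:R) :> R.
  by rewrite addrC cosDpi cosN.
by congr _%:C; rewrite cos2_half_angle; field.
Qed.

(** Eigenvalues decrease in cos t because alpha > 0, and [cos_eq1_ge] bounds cos t from below. *)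
Lemma cycle_eigenvalue_le z : odd n ->
  warmD_eigenvalue alpha (fun _ : edge G => u) z ->
  complex.Re z <= alpha * cos (pi / (2 * n%:R)) ^+ 2 - 1.
Proof.
move=> n_odd /cycle_eigenvalue_cos[t t0pi [cos1 ->]] /=.
have := cos_eq1_ge R n t n_odd t0pi cos1; rewrite cos2_half_angle => tc.
rewrite -subr_ge0.
have -> : alpha * cos (pi / (2 * n%:R)) ^+ 2 - 1 -
    (alpha - 1 - alpha / 2 * (1 + cos t)) =
  alpha / 2 * (cos t - (- (2 * cos (pi / (2 * n%:R)) ^+ 2 - 1))) by field.
by rewrite mulr_ge0 ?subr_ge0 // divr_ge0 // ltW // (lt_trans _ alpha_gt1).
Qed.

(** For even n the angle t = pi is admissible and gives the positive eigenvalue alpha - 1. *)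
Lemma cycle_even_unstable : ~~ odd n ->
  ~ linearly_stable alpha (fun _ : edge G => u).
Proof.
move=> n_even /(_ (alpha - 1)%:C) st.
have /st /= : warmD_eigenvalue alpha (fun _ : edge G => u) (alpha - 1)%:C.
  apply/cycle_eigenvalue_cos; exists pi; first by rewrite pi_ge0 lexx.
  split; first by rewrite -[_ * _]add0r cosD_even_pi ?cos0.
  by rewrite cospi subrr mulr0 subr0.
by rewrite subr_lt0 ltNge ltW.
Qed.

Let cos2_gt0 : 0 < cos (pi / (2 * n%:R)) ^+ 2 :> R.
Proof. by rewrite exprn_gt0 // cos_half_angle_gt0. Qed.

Lemma cycle_stableP : linearly_stable alpha (fun _ : edge G => u) <->
  odd n /\ alpha < cos (pi / (2 * n%:R)) ^- 2.
Proof.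
split=> [st|[n_odd]].
  have n_odd : odd n by apply/negPn/negP => /cycle_even_unstable; exact.
  split=> //; have /st /= := cycle_eigenvalue_max n_odd.
  by rewrite subr_lt0 -ltr_pdivlMr // mul1r.
rewrite -[_ ^- 2]mul1r ltr_pdivlMr // -subr_lt0 => max_lt0 z.
by move=> /(cycle_eigenvalue_le _ n_odd)/le_lt_trans; exact.
Qed.

(** At the threshold the upper bound on the real parts is exactly 0. *)
Lemma cycle_critical : odd n -> alpha = cos (pi / (2 * n%:R)) ^- 2 ->
  critical alpha (fun _ : edge G => u).
Proof.
move=> n_odd aE; split; first by move=> /cycle_stableP[_]; rewrite -aE ltxx.
move=> [z [/(cycle_eigenvalue_le _ n_odd)]].
by rewrite [X in X * _]aE mulVf ?gt_eqF // subrr leNgt => /negP.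
Qed.
End Cycle.

(** * The triangle threshold and complete graphs *)

Lemma cos_pi6_sqr (R : realType) : cos (pi / 6) ^+ 2 = 3 / 4 :> R.
Proof.
have c0 : 0 < cos (pi / 6) :> R.
  by have := pi_gt0 R => ?; apply: cos_gt0_pihalf; lra.
(* Triple angle: with c = cos (pi/6), cos (pi/2) = 0 reads c (4 c^2 - 3) = 0, and c > 0. *)
have : cos (pi / 6 + pi / 6 *+ 2) = 0 :> R.
  by rewrite -[RHS](@cos_pihalf R); congr cos; rewrite -mulr_natl; field.
rewrite cosD cos_mulr2n sin_mulr2n -[_ *+ 2]mulr_natl.
rewrite -[(cos _ * sin _) *+ 2]mulr_natl => c3.
have : cos (pi / 6) * (4 * cos (pi / 6) ^+ 2 - 3) = 0 :> R.
  rewrite -c3.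
  have -> : sin (pi / 6) * (2 * (cos (pi / 6) * sin (pi / 6))) =
      2 * cos (pi / 6) * sin (pi / 6) ^+ 2 :> R by ring.
  by rewrite sin2cos2; ring.
by move=> /eqP; rewrite mulf_eq0 gt_eqF //= subr_eq0 => /eqP; lra.
Qed.

(** An edge at [x] is determined by its other end, any of the n - 1 remaining vertices. *)
Lemma complete_regular (n : nat) (x : vertex (complete_graph n)) :
  #|[set e : edge (complete_graph n) | x \in val e]| = n.-1.
Proof.
rewrite -(card_imset _ val_inj).
have -> : [set val e | e in [set e : edge (complete_graph n) | x \in val e]] =
    [set [set x; y] | y in [set~ x]].
  apply/setP => s; apply/imsetP/imsetP => [[e]|[y]]; rewrite !inE.
    move=> xe ->; have /cards2P[a [b [ab eE]]] : #|val e| == 2.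
      by apply/eqP; exact: (edgesP (valP e)).
    move: xe; rewrite eE !inE => /orP[]/eqP->.
      by exists b => //; rewrite !inE eq_sym.
    by exists a; [rewrite !inE | rewrite finset.setUC].
  move=> yx ->.
  have sE : [set x; y] \in edges (complete_graph n).
    by rewrite inE cards2 (eq_sym x) yx.
  exists (exist _ [set x; y] sE : edge (complete_graph n)) => //.
  by rewrite inE /= set21.
rewrite card_in_imset ?cardsC1 ?card_ord // => y z; rewrite !inE => yx zx.
by move=> /setP/(_ y); rewrite !inE eqxx orbT (negPf yx) => /esym/eqP.
Qed.

(** A true equality of records, so that the cycle results transfer by rewriting. The edge sets agree
    by inclusion and cardinality 3, the proof fields by irrelevance. *)
Lemma complete_graph3 (h : (2 < 3)%N) : complete_graph 3 = cycle_graph h.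
Proof.
rewrite /complete_graph /cycle_graph.
move: (@complete_edges_card2 3) (cycle_edges_card2 h).
have -> : complete_edges 3 = cycle_edges 3.
  apply/eqP; rewrite eq_sym eqEcard; apply/andP; split.
    by apply/fintype.subsetP => e /(cycle_edges_card2 h) e2; rewrite inE e2.
  rewrite card_draws card_ord.
  have <- : #|edge (cycle_graph h)| = #|cycle_edges 3|.
    by rewrite card_sig; exact: eq_card.
  by rewrite card_edge_cycle.
by move=> p q; congr SGraph; exact: Prop_irrelevance.
Qed.

Local Close Scope complex_scope.

Theorem proposition1p20 (R : realType) (alpha : R) (halpha : 1 < alpha) :
  (forall (n : nat) (hn : (2 < n)%N),
    let G := cycle_graph hn in
    let v : edge G -> R := fun=> n%:R^-1 in
    [/\ equilibrium alpha v,
        linearly_stable alpha v <->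
          odd n /\ alpha < cos (pi / (2 * n%:R)) ^- 2
      & odd n -> alpha = cos (pi / (2 * n%:R)) ^- 2 -> critical alpha v])
  /\
  (forall (nv n : nat) (hnv : (2 < nv)%N) (hn : n = (nv * nv.-1 %/ 2)%N),
    let G := complete_graph nv in
    let v : edge G -> R := fun=> n%:R^-1 in
    [/\ equilibrium alpha v,
        linearly_stable alpha v <-> n = 3%N /\ alpha < 4 / 3
      & n = 3%N -> alpha = 4 / 3 -> critical alpha v]).
Proof.
(* Proved first because the case n = 3 also settles the complete graph on three vertices. *)
have cycle_case (n : nat) (hn : (2 < n)%N) :
    let v : edge (cycle_graph hn) -> R := fun=> n%:R^-1 in
    [/\ equilibrium alpha v,
        linearly_stable alpha v <->
          odd n /\ alpha < cos (pi / (2 * n%:R)) ^- 2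
      & odd n -> alpha = cos (pi / (2 * n%:R)) ^- 2 -> critical alpha v].
  split; first exact: cycle_equilibrium.
    exact: cycle_stableP.
  exact: cycle_critical.
split=> [n hn|nv n hnv nE]; first exact: cycle_case.
have [nv3|nv_neq3] := eqVneq nv 3%N.
  subst nv; have {nE}-> : n = 3%N by rewrite nE.
  rewrite (complete_graph3 hnv) /=; have [eq3 st3 cr3] := cycle_case 3%N hnv.
  have cE : cos (pi / (2 * 3)) ^- 2 = 4 / 3 :> R.
    have -> : 2 * 3 = 6 :> R by ring.
    by rewrite cos_pi6_sqr invf_div.
  rewrite cE in st3 cr3; split=> //; last by move=> _; exact: cr3.
  by rewrite st3; split=> -[_ ?].
have nv4 : (3 < nv)%N by rewrite ltn_neqAle eq_sym nv_neq3.
have n2E : (n * 2)%N = (nv * nv.-1)%N.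
  rewrite nE divnK // dvdn2 oddM -subn1 oddB ?(ltnW (ltnW hnv)) //.
  by case: (odd nv).
(* From 2 n = nv (nv - 1) and nv - 1 >= 3: more edges than vertices, which excludes stability and
   also n = 3. *)
have n_gt : (nv < n)%N by nia.
have n_gt0 : (0 < n)%N by lia.
have u_gt0 : 0 < n%:R^-1 :> R by rewrite invr_gt0 ltr0n.
have d_gt0 : (0 < nv.-1)%N by lia.
have cardE : #|edge (complete_graph nv)| = n.
  by rewrite card_edge_complete nE divn2.
have handshake : #|vertex (complete_graph nv)|%:R * nv.-1%:R * n%:R^-1 = 2 :> R.
  by rewrite card_ord -natrM -n2E natrM mulrAC divff ?mul1r // pnatr_eq0 -lt0n.
split.
- apply: (uniform_equilibrium _ _ _ _ _ u_gt0 d_gt0 (complete_regular nv)) =>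
    //.
  by rewrite cardE divff // pnatr_eq0 -lt0n.
- split=> [st|[n3]]; last by lia.
  suff : ~ linearly_stable alpha (fun _ : edge (complete_graph nv) => n%:R^-1).
    by [].
  apply: (uniform_unstable_of_card _ _ _ _ _ u_gt0 d_gt0 (complete_regular nv)
    handshake halpha).
  by rewrite cardE card_ord.
- by lia.
Qed.
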